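(* The $\kappa$-entanglement measure is not generally monogamous. That is, there exist finite-dimensional Hilbert spaces $\mathcal{H}_A,\mathcal{H}_B,\mathcal{H}_C$ and a tripartite state $\rho_{ABC}$ on $\mathcal{H}_A\otimes\mathcal{H}_B\otimes\mathcal{H}_C$ such that $$E_\kappa(\rho_{AB})+E_\kappa(\rho_{AC})>E_\kappa(\rho_{A(BC)}),$$ where $\rho_{AB}=\operatorname{Tr}_C\rho_{ABC}$, $\rho_{AC}=\operatorname{Tr}_B\rho_{ABC}$, and $\rho_{A(BC)}$ denotes $\rho_{ABC}$ regarded as a bipartite state with respect to the cut between $A$ and $BC$.
   Context: A bipartite state $\rho_{AB}$ is a positive semi-definite operator of unit trace on $\mathcal{H}_A\otimes\mathcal{H}_B$. The partial transpose with respect to a fixed orthonormal basis $\{|i\rangle_B\}_i$ is the linear map $T_B(X_{AB})=X_{AB}^{T_B}:=\sum_{i,j}(I_A\otimes|i\rangle\langle j|_B)X_{AB}(I_A\otimes|i\rangle\langle j|_B)$. $\kappa$-entanglement: $E_\kappa(\rho_{AB}):=\inf\{\log_2\operatorname{Tr}[S_{AB}]: S_{AB}\ge0,\ -S_{AB}^{T_B}\le\rho_{AB}^{T_B}\le S_{AB}^{T_B}\}$. An entanglement measure $E$ is monogamous if $E(\rho_{AB})+E(\rho_{AC})\le E(\rho_{A(BC)})$ for all tripartite states $\rho_{ABC}$. *)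

(* Defs.v *)
From HB Require Import structures.
From mathcomp Require Import all_boot all_order all_algebra.
From mathcomp Require Import all_classical all_reals.
From mathcomp Require Import ereal exp.
From mathcomp Require Import complex mxtens.

Set Implicit Arguments.
Unset Strict Implicit.
Unset Printing Implicit Defensive.

Import Order.TTheory GRing.Theory Num.Theory.

Local Open Scope ring_scope.
Local Open Scope classical_set_scope.
Local Open Scope sesquilinear_scope.

(* Finite-dimensional Hilbert spaces are C^n, with C = R[i]; operators on
   C^m (x) C^n are the matrices 'M_(m * n), where the basis vector |i>|j> has
   index [mxtens_index (i, j)], as for the Kronecker product [*t]. *)

(* In R[i], 0 <= z means that z is real and nonnegative; hence such an A is
   automatically Hermitian. *)
Definition psdmx (R : realType) (n : nat) (A : 'M[R[i]]_n) : Prop :=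
  forall v : 'cV[R[i]]_n, 0 <= (v ^t* *m A *m v) 0 0.

Definition loewner_le (R : realType) (n : nat) (A B : 'M[R[i]]_n) : Prop :=
  psdmx (B - A).

Definition is_state (R : realType) (n : nat) (rho : 'M[R[i]]_n) : Prop :=
  psdmx rho /\ \tr rho = 1.

(* [delta_mx i j] is |i><j| in the computational basis of the second factor. *)
Definition ptranspose (R : realType) (m n : nat) (X : 'M[R[i]]_(m * n)) :
    'M[R[i]]_(m * n) :=
  \sum_(i < n) \sum_(j < n)
    ((1%:M : 'M_m) *t delta_mx i j) *m X *m ((1%:M : 'M_m) *t delta_mx i j).

Definition log2 (R : realType) (x : R) : R := ln x / ln 2.

Definition kappa_feasible (R : realType) (m n : nat) (rho S : 'M[R[i]]_(m * n)) :
    Prop :=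
  [/\ psdmx S,
      loewner_le (- ptranspose S) (ptranspose rho)
    & loewner_le (ptranspose rho) (ptranspose S)].

(* The real part only serves to land in R: the trace of S >= 0 is real. *)
Definition E_kappa (R : realType) (m n : nat) (rho : 'M[R[i]]_(m * n)) :
    \bar R :=
  ereal_inf [set (log2 (complex.Re (\tr S)))%:E | S in kappa_feasible rho].

(* Tripartite operators are given on C^a (x) (C^b (x) C^c), so the matrix itself
   is the operator seen across the cut A : BC. *)
Definition ptraceC (R : realType) (a b c : nat) (X : 'M[R[i]]_(a * (b * c))) :
    'M[R[i]]_(a * b) :=
  \matrix_(p < a * b, q < a * b)
    let: (i, j) := mxtens_unindex p in
    let: (i', j') := mxtens_unindex q in
    \sum_(k < c) X (mxtens_index (i, mxtens_index (j, k)))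
                   (mxtens_index (i', mxtens_index (j', k))).

Definition ptraceB (R : realType) (a b c : nat) (X : 'M[R[i]]_(a * (b * c))) :
    'M[R[i]]_(a * c) :=
  \matrix_(p < a * c, q < a * c)
    let: (i, k) := mxtens_unindex p in
    let: (i', k') := mxtens_unindex q in
    \sum_(j < b) X (mxtens_index (i, mxtens_index (j, k)))
                   (mxtens_index (i', mxtens_index (j, k'))).

(* Main.v *)
(** A pure state [sum_i c_i e_i (x) f_i] with [c_i >= 0] and unit vectors [e_i],
    [f_i] has [E_kappa <= log2 ((sum_i c_i)^2)]: the feasible point is
    [S = sum_ij c_i c_j (e_i e_i^* ) (x) (f_j f_j^* )], the terms [(i, j)] and
    [(j, i)] of [S^T_B] plus or minus [rho^T_B] adding up to a multiple of some
    [w w^*].  A state on [C^n (x) C^n] has [E_kappa >= log2 <Phi|rho|Phi>] for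
    the unnormalized [Phi = sum_i |ii>], because the partial transpose of
    [Phi Phi^*] is the swap operator, whose spectrum lies in [[-1, 1]].
    For the vector [4/5 |000> + 3/5 |1> (3/5 |10> + 4/5 |01>)], equivalent to a
    W-type state, they give [E_kappa <= log2 ((7/5)^2)] across [A:BC], while
    [E_kappa >= log2 ((29/25)^2)] and [E_kappa >= log2 ((32/25)^2)] for the
    reductions to [AB] and [AC]; and [(29/25) * (32/25) > 7/5]. *)

Require Import Defs.
From mathcomp Require Import all_boot all_order all_algebra.
From mathcomp Require Import all_classical all_reals.
From mathcomp Require Import ereal exp.
From mathcomp Require Import complex mxtens.
From mathcomp Require Import ring lra.

Set Implicit Arguments.
Unset Strict Implicit.
Unset Printing Implicit Defensive.

Import Order.TTheory GRing.Theory Num.Theory.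

Local Open Scope ring_scope.
Local Open Scope sesquilinear_scope.

Section KappaEntanglement.
Variable R : realType.
Local Notation C := R[i].

(** * Positive semidefinite matrices *)

Lemma conj_realC (x : R) : Num.conj (x%:C%C : C) = x%:C%C.
Proof. by rewrite conj_Creal ?complex_real. Qed.

Lemma trmxC_mul m n p (A : 'M[C]_(m, n)) (B : 'M[C]_(n, p)) :
  (A *m B)^t* = B^t* *m A^t*.
Proof. by rewrite trmx_mul map_mxM. Qed.

Lemma psdmxMtrC n k (u : 'M[C]_(n, k)) : psdmx (u *m u^t*).
Proof.
move=> v; set w := u^t* *m v.
have -> : v^t* *m (u *m u^t*) *m v = w^t* *m w.
  rewrite /w trmxC_mul !mulmxA; congr (_ *m _ *m _ *m _).
  by apply/matrixP=> i j; rewrite !mxE conjCK.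
by rewrite mxE sumr_ge0 // => i _; rewrite !mxE mulrC -normCK exprn_ge0.
Qed.

(** The brackets exchange under swapping [u] and [v], so the right side has the shape
    [G i j + G j i] of [psdmx_symmetrize] once [u] is [u i j] and [v] is [u j i]. *)
Lemma mulmxMtrCD n k (u v : 'M[C]_(n, k)) :
  (u + v) *m (u + v)^t* =
  (u *m v^t* + u *m u^t*) + (v *m u^t* + v *m v^t*).
Proof.
have -> : (u + v)^t* = u^t* + v^t* by apply/matrixP=> a b; rewrite !mxE rmorphD.
by rewrite mulmxDl !mulmxDr [u *m u^t* + _]addrC.
Qed.

Lemma mulmxMtrCB n k (u v : 'M[C]_(n, k)) :
  (u - v) *m (u - v)^t* =
  (u *m u^t* - u *m v^t*) + (v *m v^t* - v *m u^t*).
Proof.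
have -> : (u - v)^t* = u^t* - v^t* by apply/matrixP=> a b; rewrite !mxE rmorphB.
by rewrite mulmxBl !mulmxBr opprB.
Qed.

Lemma psdmxD n (A B : 'M[C]_n) : psdmx A -> psdmx B -> psdmx (A + B).
Proof. by move=> pA pB v; rewrite mulmxDr mulmxDl mxE addr_ge0. Qed.

Lemma psdmxZ n (k : C) (A : 'M[C]_n) : 0 <= k -> psdmx A -> psdmx (k *: A).
Proof. by move=> k0 pA v; rewrite -scalemxAr -scalemxAl mxE mulr_ge0. Qed.

Lemma psdmx_sum n (I : finType) (F : I -> 'M[C]_n) :
  (forall i, psdmx (F i)) -> psdmx (\sum_i F i).
Proof.
move=> pF; elim/big_ind: _ => //; last exact: psdmxD.
by move=> v; rewrite mulmx0 mul0mx mxE.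
Qed.

(** The double sum is half the sum of the [G i j + G j i]; a single [G i j] may fail to be
    Hermitian. *)
Lemma psdmx_symmetrize n (I : finType) (G : I -> I -> 'M[C]_n) :
  (forall i j, psdmx (G i j + G j i)) -> psdmx (\sum_i \sum_j G i j).
Proof.
move=> pG; set S := (X in psdmx X).
have -> : S = 2^-1 *: \sum_i \sum_j (G i j + G j i).
  under eq_bigr do rewrite big_split /=.
  rewrite big_split /= [X in _ + X]exchange_big -/S -mulr2n.
  by rewrite -[S *+ 2](@scaler_nat C) scalerA mulVf ?scale1r // pnatr_eq0.
by apply: psdmxZ; [rewrite invr_ge0 ler0n | do 2 apply: psdmx_sum => ?].
Qed.

(** * Tensor products and the partial transpose *)

Lemma trmxC_tens m n p q (A : 'M[C]_(m, n)) (B : 'M[C]_(p, q)) :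
  (A *t B)^t* = A^t* *t B^t*.
Proof. by rewrite trmx_tens map_mxT. Qed.

Lemma tens_colMtrC m n (a b : 'cV[C]_m) (f g : 'cV[C]_n) :
  (a *t f : 'cV_(m * n)) *m (b *t g : 'cV_(m * n))^t* =
  (a *m b^t*) *t (f *m g^t*).
Proof.
by rewrite [X in _ *m X](trmxC_tens b g); exact: (tensmx_mul a f (b^t*) (g^t*)).
Qed.

Lemma mxtrace_tens m n (A : 'M[C]_m) (B : 'M[C]_n) :
  \tr (A *t B) = \tr A * \tr B.
Proof.
rewrite /mxtrace mulr_sum.
apply: eq_bigr => k _; case: (mxtens_indexP k) => i j.
by rewrite tensmxE mxtens_indexK.
Qed.

Lemma tens1delta_mulmx m n p (a b : 'I_n) (X : 'M[C]_(m * n, p)) i j q :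
  ((1%:M *t delta_mx a b) *m X) (mxtens_index (i, j)) q =
  (j == a)%:R * X (mxtens_index (i, b)) q.
Proof.
rewrite mxE (bigD1 (mxtens_index (i, b))) //= tensmxE !mxE !eqxx mul1r andbT.
rewrite big1 ?addr0 // => k; case: (mxtens_indexP k) => i1 j1 ne.
rewrite tensmxE !mxE; case: eqP => [e|]; last by rewrite !mul0r.
case: (j1 =P b) => [e'|]; last by rewrite andbF mulr0 mul0r.
by rewrite e e' eqxx in ne.
Qed.

Lemma mulmx_tens1delta m n p (a b : 'I_n) (X : 'M[C]_(p, m * n)) i j q :
  (X *m (1%:M *t delta_mx a b)) q (mxtens_index (i, j)) =
  (j == b)%:R * X q (mxtens_index (i, a)).
Proof.
have -> : X *m (1%:M *t delta_mx a b) = ((1%:M *t delta_mx b a) *m X^T)^T.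
  by rewrite trmx_mul trmx_tens trmx1 trmx_delta trmxK.
by rewrite mxE tens1delta_mulmx mxE.
Qed.

(** In the defining double sum only the term of [delta_mx j j'] has a nonzero entry at this
    position. *)
Lemma ptransposeE m n (X : 'M[C]_(m * n)) i j i' j' :
  ptranspose X (mxtens_index (i, j)) (mxtens_index (i', j')) =
  X (mxtens_index (i, j')) (mxtens_index (i', j)).
Proof.
rewrite summxE (bigD1 j) //= [X in _ + X]big1 ?addr0 => [|a ne].
  rewrite summxE (bigD1 j') //= [X in _ + X]big1 ?addr0 => [|b ne].
    by rewrite mulmx_tens1delta tens1delta_mulmx !eqxx !mul1r.
  by rewrite mulmx_tens1delta eq_sym (negPf ne) mul0r.
rewrite summxE big1 // => b _.
rewrite mulmx_tens1delta tens1delta_mulmx [j == a]eq_sym (negPf ne).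
by rewrite mul0r mulr0.
Qed.

Lemma ptranspose_sum m n (I : finType) (F : I -> 'M[C]_(m * n)) :
  ptranspose (\sum_i F i) = \sum_i ptranspose (F i).
Proof.
apply/matrixP => p q; case: (mxtens_indexP p) => i j.
case: (mxtens_indexP q) => i' j'; rewrite ptransposeE !summxE.
by apply: eq_bigr => k _; rewrite ptransposeE.
Qed.

Lemma ptransposeZ m n (k : C) (X : 'M[C]_(m * n)) :
  ptranspose (k *: X) = k *: ptranspose X.
Proof.
apply/matrixP => p q; case: (mxtens_indexP p) => i j.
by case: (mxtens_indexP q) => i' j'; rewrite ptransposeE !mxE ptransposeE.
Qed.

Lemma ptranspose_tens m n (A : 'M[C]_m) (B : 'M[C]_n) :
  ptranspose (A *t B) = A *t B^T.
Proof.
apply/matrixP => p q; case: (mxtens_indexP p) => i j.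
by case: (mxtens_indexP q) => i' j'; rewrite ptransposeE !tensmxE mxE.
Qed.

(** * Upper bound from a Schmidt-type decomposition *)

Lemma E_kappa_schmidt_le m n k (c : 'I_k -> R)
    (e : 'I_k -> 'cV[C]_m) (f : 'I_k -> 'cV[C]_n)
    (c_ge0 : forall i, 0 <= c i)
    (e1 : forall i, (e i)^t* *m e i = 1%:M)
    (f1 : forall i, (f i)^t* *m f i = 1%:M)
    (psi : 'cV[C]_(m * n)) :
  psi = \sum_i (c i)%:C%C *: (e i *t f i) ->
  (E_kappa (psi *m psi^t*) <= (log2 ((\sum_i c i) ^+ 2))%:E)%E.
Proof.
move=> psiE; pose cc i j : C := (c i)%:C%C * (c j)%:C%C.
have cc_ge0 i j : 0 <= cc i j by rewrite mulr_ge0 // lecR.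
pose S := \sum_i \sum_j
  cc i j *: ((e i *m (e i)^t*) *t (f j *m (f j)^t*)).
(* Partial transposition turns [psi psi^*] into the sum of the
   [cc i j *: u i j (u j i)^*], and [S] into that of the
   [cc i j *: u i j (u i j)^*]. *)
pose u i j : 'cV_(m * n) := e i *t ((f j)^t*)^T.
have ptS : ptranspose S = \sum_i \sum_j cc i j *: (u i j *m (u i j)^t*).
  rewrite ptranspose_sum; apply: eq_bigr => i _.
  rewrite ptranspose_sum; apply: eq_bigr => j _.
  rewrite ptransposeZ ptranspose_tens tens_colMtrC trmx_mul.
  congr (_ *: (_ *t (_ *m _))); by apply/matrixP => a b; rewrite !mxE ?conjCK.
have ptrho : ptranspose (psi *m psi^t*) =
    \sum_i \sum_j cc i j *: (u i j *m (u j i)^t*).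
  have -> : psi^t* = \sum_j (c j)%:C%C *: (e j *t f j : 'cV_(m * n))^t*.
    rewrite psiE !raddf_sum; apply: eq_bigr => j _.
    apply/matrixP => a b; rewrite !mxE [LHS]rmorphM.
    by congr (_ * _); apply: conj_realC.
  rewrite {1}psiE mulmx_suml ptranspose_sum; apply: eq_bigr => i _.
  rewrite mulmx_sumr ptranspose_sum; apply: eq_bigr => j _.
  rewrite -scalemxAl -scalemxAr scalerA ptransposeZ.
  (* Transposing [f i *m (f j)^t*] exchanges the two vectors and conjugates them: hence [u i j]
     meets [u j i], not itself. *)
  rewrite !tens_colMtrC ptranspose_tens trmx_mul.
  congr (_ *: (_ *t (_ *m _))); by apply/matrixP => a b; rewrite !mxE ?conjCK.
apply: ereal_inf_lbound; exists S.
  split; rewrite /loewner_le ?ptS ?ptrho ?opprK.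
  - do 2! apply: psdmx_sum => ?; apply: psdmxZ => //.
    by rewrite -tens_colMtrC; exact: psdmxMtrC.
  - rewrite -big_split /=; under eq_bigr do rewrite -big_split /=.
    apply: psdmx_symmetrize => i j.
    have -> : cc j i = cc i j by rewrite /cc mulrC.
    rewrite -!scalerDr; apply: psdmxZ => //.
    by rewrite -mulmxMtrCD; exact: psdmxMtrC.
  - rewrite -sumrB /=; under eq_bigr do rewrite -sumrB /=.
    apply: psdmx_symmetrize => i j.
    have -> : cc j i = cc i j by rewrite /cc mulrC.
    rewrite -!scalerBr -scalerDr; apply: psdmxZ => //.
    by rewrite -mulmxMtrCB; exact: psdmxMtrC.
have trMtrC p (v : 'cV[C]_p) : v^t* *m v = 1%:M -> \tr (v *m v^t*) = 1.
  by move=> v1; rewrite mxtrace_mulC v1 mxtrace1.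
(* Each tensor factor in [S] is a projector of trace 1, so the trace is the sum of the [cc i j]. *)
suff -> : \tr S = ((\sum_i c i) ^+ 2)%:C%C by [].
rewrite raddf_sum expr2 rmorphM rmorph_sum mulr_suml; apply: eq_bigr => i _.
rewrite raddf_sum mulr_sumr; apply: eq_bigr => j _.
by rewrite /= mxtraceZ mxtrace_tens !trMtrC // !mulr1.
Qed.

(** * Lower bound from the overlap with [Phi] *)

Lemma sum_mxtens (V : nmodType) m n (F : 'I_(m * n) -> V) :
  \sum_p F p = \sum_i \sum_j F (mxtens_index (i, j)).
Proof.
rewrite pair_big (reindex (@mxtens_index m n)); first by apply: eq_bigr => -[].
exists (@mxtens_unindex m n) => p _; first exact: mxtens_indexK.
exact: mxtens_unindexK.
Qed.

(** These are the values of the quadratic form at the sum and the difference of two basis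
    vectors. *)
Lemma psdmx_pair n (A : 'M[C]_n) p q : psdmx A ->
  0 <= A p p + A p q + (A q p + A q q) /\
  0 <= A p p - A p q - (A q p - A q q).
Proof.
pose d r : 'cV[C]_n := delta_mx r 0.
have dA r s : ((d r)^t* *m A *m d s) 0 0 = A r s.
  by rewrite trmx_delta map_delta_mx -rowE -colE !mxE.
move=> psdA; split; rewrite -!dA.
  have := psdA (d p + d q).
  have -> : (d p + d q)^t* = (d p)^t* + (d q)^t*.
    by apply/matrixP=> a b; rewrite !mxE rmorphD.
  by rewrite !mulmxDl !mulmxDr !mxE.
have := psdA (d p - d q).
have -> : (d p - d q)^t* = (d p)^t* - (d q)^t*.
  by apply/matrixP=> a b; rewrite !mxE rmorphB.
by rewrite !mulmxBl !mulmxBr !mxE.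
Qed.

(** [F] is [<Phi|rho|Phi>]. No spectral theory enters: the swap eigenvectors [|ij> + |ji>] and
    [|ij> - |ji>] are tested on [S^T_B - rho^T_B] and [S^T_B + rho^T_B] respectively. Adding the two
    bounds the entries of [rho] at [(ii, jj)] and [(jj, ii)] by diagonal entries of [S]. *)
Lemma E_kappa_ge_fidelity n (rho : 'M[C]_(n * n)) :
  let F := \sum_i \sum_j rho (mxtens_index (i, i)) (mxtens_index (j, j)) in
  0 < complex.Re F -> ((log2 (complex.Re F))%:E <= E_kappa rho)%E.
Proof.
move=> F F_gt0; apply: le_ereal_inf_tmp => _ [S [_ psdYX psdXY] <-].
(* Doubling lets the terms [(i, j)] and [(j, i)] be compared together. *)
have FS : F *+ 2 <= \tr S *+ 2.
  have -> : \tr S *+ 2 = \sum_i \sum_j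
     (S (mxtens_index (i, j)) (mxtens_index (i, j)) +
     S (mxtens_index (j, i)) (mxtens_index (j, i))).
    under eq_bigr do rewrite big_split /=.
    by rewrite big_split /= [X in _ + X]exchange_big /= /mxtrace sum_mxtens.
  have -> : F *+ 2 = \sum_i \sum_j
     (rho (mxtens_index (i, i)) (mxtens_index (j, j)) +
     rho (mxtens_index (j, j)) (mxtens_index (i, i))).
    under eq_bigr do rewrite big_split /=.
    by rewrite big_split /= [X in _ + X]exchange_big.
  apply: ler_sum => i _; apply: ler_sum => j _.
  set p := mxtens_index (i, j); set q := mxtens_index (j, i).
  have [_] := psdmx_pair p q psdYX; have [+ _] := psdmx_pair p q psdXY.
  have ringE (a b c d a' b' c' d' : C) :
      a - a' + (b - b') + (c - c' + (d - d')) +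
      (a' - - a - (b' - - b) - (c' - - c - (d' - - d))) =
      (a + d - (b' + c')) * 2 by ring.
  move=> h1 h2; rewrite -subr_ge0 -(@pmulr_lge0 _ 2) ?ltr0n //.
  have := addr_ge0 h1 h2; rewrite !mxE !ptransposeE -/p -/q.
  by rewrite ringE.
have {}FS : complex.Re F <= complex.Re (\tr S).
  by move: FS; rewrite ler_pMn2r // lecE => /andP[].
rewrite lee_fin /log2 ler_pM2r ?invr_gt0 ?ln_gt0 ?ltr1n //.
(* Positivity of [Re F] passes to the trace, so both arguments lie where [ln] is increasing. *)
by rewrite ler_ln ?posrE // (lt_le_trans F_gt0).
Qed.

(** * The W-type state and its three bounds *)

Definition wstate_coef (i : 'I_2) : R := if i == 0 then 4 / 5 else 3 / 5.

(** The triple 3, 4, 5 keeps all norms and overlaps rational. *)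
Definition wstate_amp (i j k : 'I_2) : R :=
  match val i, val j, val k with
  | 0%N, 0%N, 0%N => 1
  | 1%N, 1%N, 0%N => 3 / 5
  | 1%N, 0%N, 1%N => 4 / 5
  | _, _, _ => 0
  end.

Definition wstate_vec (i : 'I_2) : 'cV[C]_(2 * 2) :=
  \col_q (wstate_amp i (mxtens_unindex q).1 (mxtens_unindex q).2)%:C%C.

(** Already decomposed across [A:BC], so [E_kappa_schmidt_le] applies by reflexivity. *)
Definition wstate : 'cV[C]_(2 * (2 * 2)) :=
  \sum_i (wstate_coef i)%:C%C *: ((delta_mx i 0 : 'cV_2) *t wstate_vec i).

Lemma wstate_vecE i j k z :
  wstate_vec i (mxtens_index (j, k)) z = (wstate_amp i j k)%:C%C.
Proof. by rewrite mxE mxtens_indexK. Qed.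

Lemma wstateE i j k z :
  wstate (mxtens_index (i, mxtens_index (j, k))) z =
  (wstate_coef i * wstate_amp i j k)%:C%C.
Proof.
have tensE l : ((delta_mx l 0 : 'cV_2) *t wstate_vec l : 'cV_(2 * (2 * 2)))
    (mxtens_index (i, mxtens_index (j, k))) z =
    (i == l)%:R * (wstate_amp l j k)%:C%C.
  (* The column index is recast in ['I_(1 * 1)] to fit [tensmxE]. *)
  rewrite -[z](@mxtens_unindexK 1 1); case: (mxtens_unindex _) => a b.
  rewrite [LHS](@tensmxE _ 2 1 (2 * 2) 1) wstate_vecE mxE [a]ord1 eqxx.
  by rewrite andbT.
rewrite summxE (bigD1 i) //= mxE tensE eqxx mul1r rmorphM.
rewrite big1 ?addr0 // => l ne.
by rewrite mxE tensE eq_sym (negPf ne) mul0r mulr0.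
Qed.

Lemma wstate_densityE i j k i' j' k' :
  (wstate *m wstate^t*) (mxtens_index (i, mxtens_index (j, k)))
     (mxtens_index (i', mxtens_index (j', k'))) =
  (wstate_coef i * wstate_amp i j k *
    (wstate_coef i' * wstate_amp i' j' k'))%:C%C.
Proof.
rewrite mxE big_ord1 !mxE !wstateE [RHS]rmorphM; congr (_ * _).
exact: conj_realC.
Qed.

Lemma wstate_state : is_state (wstate *m wstate^t*).
Proof.
split; first exact: psdmxMtrC.
rewrite /mxtrace sum_mxtens.
under eq_bigr do rewrite sum_mxtens.
under eq_bigr do under eq_bigr do under eq_bigr do rewrite wstate_densityE.
under eq_bigr do under eq_bigr do rewrite -rmorph_sum.
under eq_bigr do rewrite -rmorph_sum.
rewrite -rmorph_sum /=; congr (_%:C)%C.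
by rewrite !big_ord_recl !big_ord0 /wstate_coef /wstate_amp /=; field.
Qed.

Lemma E_kappa_wstate_le :
  (E_kappa (wstate *m wstate^t*) <= (log2 ((7 / 5) ^+ 2))%:E)%E.
Proof.
have -> : 7 / 5 = \sum_i wstate_coef i.
  by rewrite !big_ord_recl big_ord0 /wstate_coef /=; field.
apply: E_kappa_schmidt_le (erefl _) => i.
- by rewrite /wstate_coef; case: ifP => _; lra.
- by rewrite trmx_delta map_delta_mx mul_delta_mx;
     apply/matrixP=> a b; rewrite !mxE !ord1.
apply/matrixP=> a b; rewrite !ord1 !mxE sum_mxtens.
under eq_bigr do under eq_bigr do
  rewrite !mxE !mxtens_indexK conj_realC -rmorphM.
under eq_bigr do rewrite -rmorph_sum.
rewrite -rmorph_sum /=; congr (_%:C)%C.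
by case: i => -[|[|//]] ilt;
  rewrite !big_ord_recl !big_ord0 /wstate_amp /=; field.
Qed.

(** The branch [k = 0] is [4/5 |00> + 9/25 |11>], with overlap [29/25]; the branch [k = 1], a
    multiple of [|10>], is orthogonal to [Phi]. *)
Lemma E_kappa_wstateC_ge :
  ((log2 ((29 / 25) ^+ 2))%:E <= E_kappa (ptraceC (wstate *m wstate^t*)))%E.
Proof.
have FE : \sum_i \sum_j ptraceC (wstate *m wstate^t*)
    (mxtens_index (i, i)) (mxtens_index (j, j)) = ((29 / 25) ^+ 2)%:C%C.
  under eq_bigr do under eq_bigr do rewrite mxE !mxtens_indexK.
  under eq_bigr do under eq_bigr do under eq_bigr do rewrite wstate_densityE.
  under eq_bigr do under eq_bigr do rewrite -rmorph_sum.
  under eq_bigr do rewrite -rmorph_sum.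
  rewrite -rmorph_sum /=; congr (_%:C)%C.
  by rewrite !big_ord_recl !big_ord0 /wstate_coef /wstate_amp /=; field.
have := E_kappa_ge_fidelity (rho := ptraceC (wstate *m wstate^t*)).
by rewrite FE /=; apply; lra.
Qed.

(** The branch [j = 0] is [4/5 |00> + 12/25 |11>], with overlap [32/25]; the branch [j = 1] is
    orthogonal to [Phi]. *)
Lemma E_kappa_wstateB_ge :
  ((log2 ((32 / 25) ^+ 2))%:E <= E_kappa (ptraceB (wstate *m wstate^t*)))%E.
Proof.
have FE : \sum_i \sum_j ptraceB (wstate *m wstate^t*)
    (mxtens_index (i, i)) (mxtens_index (j, j)) = ((32 / 25) ^+ 2)%:C%C.
  under eq_bigr do under eq_bigr do rewrite mxE !mxtens_indexK.
  under eq_bigr do under eq_bigr do under eq_bigr do rewrite wstate_densityE.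
  under eq_bigr do under eq_bigr do rewrite -rmorph_sum.
  under eq_bigr do rewrite -rmorph_sum.
  rewrite -rmorph_sum /=; congr (_%:C)%C.
  by rewrite !big_ord_recl !big_ord0 /wstate_coef /wstate_amp /=; field.
have := E_kappa_ge_fidelity (rho := ptraceB (wstate *m wstate^t*)).
by rewrite FE /=; apply; lra.
Qed.

End KappaEntanglement.

Theorem proposition12 (R : realType) :
  exists (a b c : nat) (rho : 'M[R[i]]_(a * (b * c))),
    is_state rho /\
    (E_kappa (ptraceC rho) + E_kappa (ptraceB rho) > E_kappa rho)%E.
Proof.
exists 2, 2, 2, (wstate R *m (wstate R)^t*); split; first exact: wstate_state.
apply: (le_lt_trans (E_kappa_wstate_le R)).
apply: lt_le_trans (leeD (E_kappa_wstateC_ge R) (E_kappa_wstateB_ge R)).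
rewrite -EFinD lte_fin /log2 -mulrDl ltr_pM2r ?invr_gt0 ?ln_gt0 ?ltr1n //.
rewrite -lnM ?posrE; [|lra|lra].
(* What remains is the square of [928/625 > 875/625]. *)
rewrite ltr_ln ?posrE; lra.
Qed.
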